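(* Let $U$ be the collection of $\equiv_m^{\mathbf{P}}$-invariant Borel sets $A \subseteq \mathcal{P}(2^{<\omega})$ such that player I has a winning strategy in the game $G_A$. Then the set $\{x \in \mathcal{P}(2^{<\omega}) : \mathbf{P}^x = \mathbf{NP}^x\}$ belongs to $U$.
   Context: $2^{<\omega}$ is the set of all finite binary strings. A language (or oracle) is an element of $\mathcal{P}(2^{<\omega})$, which is identified via characteristic functions with the Polish space $2^{2^{<\omega}}$ (product topology). $\mathbf{P}^x$ and $\mathbf{NP}^x$ are the classes of languages decidable in deterministic, respectively nondeterministic, polynomial time relative to the oracle $x$. Convention on oracle access: a computation which uses $n$ space may query only oracle strings of length at most $n$. $\equiv_m^{\mathbf{P}}$ is polynomial time many-one equivalence: $x \equiv_m^{\mathbf{P}} y$ iff each of $x,y$ is many-one reducible to the other via a polynomial time computable many-one reduction. A set $A$ of languages is $\equiv_m^{\mathbf{P}}$-invariant if $x \equiv_m^{\mathbf{P}} y$ implies $x \in A \iff y \in A$. The game $G_A$, for $A \subseteq \mathcal{P}(2^{<\omega})$: players I and II alternate defining which strings are in a language $x$. On turn $n$ ($n \geq 1$), first player I decides membership in $x$ for all strings of length $n$ beginning with a $0$, and then player II decides membership in $x$ for all strings of length $n$ beginning with a $1$. Thus the resulting $x$ is the recursive join $y \oplus z = \{0s : s \in y\} \cup \{1s : s \in z\}$ (where $0s$ and $1s$ denote the concatenation of the one-symbol string $0$, respectively $1$, with the string $s$) of the languages $y$ and $z$ played by I and II respectively. The game has perfect information. Player I wins if $x \in A$; otherwise player II wins.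 *)

(* Defs.v *)
From mathcomp Require Import all_boot all_order all_algebra.
From mathcomp Require Import all_classical topology measurable_structure.

Set Implicit Arguments.
Unset Strict Implicit.
Unset Printing Implicit Defensive.

Local Open Scope classical_set_scope.

(* {ptws _ -> _} carries the product topology and bool the discrete one, so
   this is the Polish space 2^(2^{<omega}). *)
Definition language : Type := {ptws seq bool -> bool}.

Definition Borel_language : set (set language) := <<s @open language >>.

(* The tape alphabet {0, 1, blank}; [None] is the blank. *)
Definition symbol := option bool.

(* A two-way infinite tape: [tleft] lists the cells to the left of the head,
   nearest first; [tright] lists the scanned cell and those to its right.
   All cells beyond these lists are blank. *)
Record tape := Tape { tleft : seq symbol; tright : seq symbol }.

(* Trailing blanks are never stored, so each tape content with a given head
   position has one representation. *)
Definition push (a : symbol) (s : seq symbol) : seq symbol :=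
  if (a == None) && nilp s then [::] else a :: s.

Definition blank_tape : tape := Tape [::] [::].
Definition input_on_tape (w : seq bool) : tape := Tape [::] (map some w).

Definition scanned (t : tape) : symbol := head None (tright t).

Definition write (a : symbol) (t : tape) : tape :=
  Tape (tleft t) (push a (behead (tright t))).

Inductive direction := GoLeft | Stay | GoRight.

Definition move (d : direction) (t : tape) : tape :=
  match d with
  | GoLeft => Tape (behead (tleft t)) (push (head None (tleft t)) (tright t))
  | Stay => t
  | GoRight => Tape (push (scanned t) (tleft t)) (behead (tright t))
  end.

Fixpoint bits_before_blank (s : seq symbol) : seq bool :=
  if s is Some b :: s' then b :: bits_before_blank s' else [::].

(* The word on a tape: it starts in the scanned cell and extends to the right
   up to the first blank. *)
Definition tape_word (t : tape) : seq bool := bits_before_blank (tright t).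

(* What a machine with states [Q] and tapes indexed by [K] does in a state.
   [Step d]: nondeterministically choose one of the two transition functions
   [d false], [d true] and apply it to the scanned symbols; the result is the
   next state and, for each tape, the symbol to write and the head move. *)
Inductive instruction (Q K : Type) : Type :=
  | Halt (accept : bool)
  | Query (yes no : Q)
  | Step (d : bool -> (K -> symbol) -> Q * (K -> symbol * direction)).
Arguments Halt {Q K}.
Arguments Query {Q K}.
Arguments Step {Q K}.

(* A multitape oracle Turing machine, in general nondeterministic.
   The word on [output_tape] is the string queried at a [Query] instruction
   and the value computed at a [Halt] instruction.  This tape is initially
   blank and is written one cell per step, so its cells count as used space
   (and time): a computation can only query strings no longer than the space
   it uses. *)
Record machine : Type := Machine {
  state : finType;
  tape_index : finType;
  input_tape : tape_index;
  output_tape : tape_index;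
  input_neq_output : input_tape != output_tape;
  start : state;
  program : state -> instruction state tape_index }.

Definition deterministic (M : machine) : Prop :=
  forall (q : state M) d, program q = Step d -> forall r, d false r = d true r.

Definition oracle_free (M : machine) : Prop :=
  forall (q yes no : state M), program q <> Query yes no.

Record config (M : machine) : Type := Config {
  cstate : state M;
  ctape : tape_index M -> tape }.

Definition initial (M : machine) (w : seq bool) : config M :=
  Config (start M)
    (fun k => if k == input_tape M then input_on_tape w else blank_tape).

(* One step with oracle [x], the nondeterministic choice being [g]; halted
   configurations stay unchanged. *)
Definition step (M : machine) (x : language) (c : config M) (g : bool) :
    config M :=
  match program (cstate c) with
  | Halt _ => c
  | Query yes no =>
      Config (if x (tape_word (ctape c (output_tape M))) then yes else no)
             (ctape c)
  | Step d =>
      let: (q, act) := d g (fun k => scanned (ctape c k)) in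
      Config q (fun k => move (act k).2 (write (act k).1 (ctape c k)))
  end.

Definition run (M : machine) (x : language) (w gs : seq bool) : config M :=
  foldl (step x) (initial M w) gs.

Definition halted (M : machine) (c : config M) : Prop :=
  exists b, program (cstate c) = Halt b.

Definition accepting (M : machine) (c : config M) : Prop :=
  program (cstate c) = Halt true.

Definition poly_time (M : machine) (x : language) : Prop :=
  exists p : {poly nat}, forall w gs : seq bool,
    size gs = p.[size w]%R -> halted (run M x w gs).

Definition accepts (M : machine) (x : language) (w : seq bool) : Prop :=
  exists gs : seq bool, accepting (run M x w gs).

Definition NP_rel (x : language) : set language :=
  [set L | exists2 M : machine, poly_time M x &
           forall w, L w <-> accepts M x w].

Definition P_rel (x : language) : set language :=
  [set L | exists M : machine, [/\ deterministic M, poly_time M x &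
           forall w, L w <-> accepts M x w]].

(* The machine is oracle-free, so the oracle passed to [poly_time] and [run] is
   irrelevant; the machine is deterministic, so the choices [gs] are too. *)
Definition poly_time_computable (f : seq bool -> seq bool) : Prop :=
  exists M : machine,
    [/\ deterministic M, oracle_free M, poly_time M (fun=> false) &
     forall w gs, halted (run M (fun=> false) w gs) ->
       tape_word (ctape (run M (fun=> false) w gs) (output_tape M)) = f w].

Definition many_one_reducible (x y : language) : Prop :=
  exists2 f, poly_time_computable f & forall w, x w = y (f w).

Definition many_one_equiv (x y : language) : Prop :=
  many_one_reducible x y /\ many_one_reducible y x.

Definition many_one_invariant (A : set language) : Prop :=
  forall x y, many_one_equiv x y -> (A x <-> A y).

(* The language resulting from a play; the empty string, which no player
   decides, is not in it. *)
Definition join (y z : language) : language :=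
  fun w => if w is b :: s then (if b then z s else y s) else false.

(* The position at the beginning of turn [n], as the set of the strings of
   length less than [n] which have been put in [x]. *)
Definition position (n : nat) (x : language) : language :=
  fun w => (size w < n) && x w.

(* [sigma n h s], used for [size s = n.-1] only, tells whether I puts the string
   [false :: s] of length [n] in [x] on turn [n], when the position is [h]. *)
Definition strategyI := nat -> language -> seq bool -> bool.

Definition follows (sigma : strategyI) (y z : language) : Prop :=
  forall n s, size s = n ->
    y s = sigma n.+1 (position n.+1 (join y z)) s.

Definition winningI (A : set language) (sigma : strategyI) : Prop :=
  forall y z, follows sigma y z -> A (join y z).

Definition U : set (set language) :=
  [set A | [/\ many_one_invariant A, Borel_language A &
           exists sigma, winningI A sigma]].

(* Main.v *)
Require Import Defs.
From HB Require Import structures.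
From mathcomp Require Import all_boot all_order all_algebra.
From mathcomp Require Import all_classical topology measurable_structure.
From mathcomp Require Import zify.

(**
  Strategy of player I.  The machines are enumerated so that each of them has
  arbitrarily large indices.  For a word [w], player I puts the string
  [1^((|w|+2)^(k+1)) 0 rev(w)] in the language [y] that I plays iff the machine
  of index [k] accepts [w] with oracle [x], the join of [y] and the language of
  II, along some sequence of [(|w|+2)^(k+1)] choices.
  A query made at step [i] has length at most [i], so these runs only consult
  [x] on strings shorter than the string being decided, and the position
  determines the answer ([run_local], [winning_strategy]).  The index [k] also
  plays the part of the exponent: a machine running in polynomial time with
  oracle [x] has an index [k] for which [(n+2)^(k+1)] exceeds its running time,
  and its language is then decided by a deterministic machine that writes the
  padded string and queries it ([pad_accepts]).  No universal machine occurs: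
  the strategy need not be computable, and the deterministic machine only
  writes padding.

  Invariance.  If [x] is reducible to [y], a machine with oracle [x] can be
  imitated with oracle [y] by computing the reduction on each of its queries
  ([reduce_oracle]).  The reduction is run many times on the same tapes, which
  have to be blank at the start of each run; companion tapes mark the visited
  cells, so that all of them can be erased afterwards.  From [P^x = NP^x] and
  two reductions, a nondeterministic machine with oracle [y] is turned into one
  with oracle [x], then into a deterministic one, then into a deterministic one
  with oracle [y].

  Borel complexity.  A run of given length depends on finitely many values of
  the oracle ([Borel_run]), and all quantifiers in the definition of the set
  range over countable types, once machines are replaced by their indices
  ([Borel_P_eq_NP]).
*)

Set Implicit Arguments.
Unset Strict Implicit.
Unset Printing Implicit Defensive.

Local Open Scope classical_set_scope.

(** * Polynomial bounds *)

(** Powers of [n + 2] suffice: as the base is at least 2, a larger exponent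
    absorbs sums and constant factors. *)
Definition poly_bounded (f : nat -> nat) : Prop :=
  exists k, forall n, f n <= n.+2 ^ k.

Lemma leq_exp2 n a b : a <= b -> n.+2 ^ a <= n.+2 ^ b.
Proof. exact: leq_pexp2l. Qed.

Lemma leq_expl a b n : a <= b -> a ^ n <= b ^ n.
Proof. by case: n => // n; rewrite leq_exp2r. Qed.

Lemma poly_bounded_id : poly_bounded id.
Proof. by exists 1 => n; rewrite expn1; lia. Qed.

Lemma poly_bounded_const c : poly_bounded (fun=> c).
Proof.
exists c => n; rewrite (leq_trans (ltnW (ltn_expl c (ltnSn 1)))) //.
exact: leq_expl.
Qed.

Lemma poly_bounded_mul f g :
  poly_bounded f -> poly_bounded g -> poly_bounded (fun n => f n * g n).
Proof.
move=> [a fa] [b gb]; exists (a + b) => n.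
by rewrite expnD leq_mul.
Qed.

Lemma poly_bounded_add f g :
  poly_bounded f -> poly_bounded g -> poly_bounded (fun n => f n + g n).
Proof.
move=> [a fa] [b gb]; exists (a + b).+1 => n; rewrite expnS.
have ab := leq_trans (fa n) (leq_exp2 n (leq_addr b a)).
have ba := leq_trans (gb n) (leq_exp2 n (leq_addl a b)).
nia.
Qed.

Lemma poly_bounded_comp f g :
  poly_bounded f -> poly_bounded g -> poly_bounded (fun n => f (g n)).
Proof.
move=> [a fa] [b gb]; exists (b.+2 * a) => n.
apply: leq_trans (fa _) _; rewrite expnM.
suff le2 : (g n).+2 <= n.+2 ^ b.+2 by apply: leq_expl.
have p1 : 0 < n.+2 ^ b by rewrite expn_gt0.
have := gb n; rewrite !expnS; nia.
Qed.

Lemma poly_bounded_horner (p : {poly nat}) : poly_bounded (fun n => p.[n]%R).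
Proof.
elim/poly_ind: p => [|p c IHp].
  by exists 0 => n; rewrite horner0.
have [k Hk] := poly_bounded_add (poly_bounded_mul IHp poly_bounded_id)
                                (poly_bounded_const c).
by exists k => n; rewrite hornerD hornerM hornerX hornerC; apply: Hk.
Qed.

(** * Runs *)

Section Runs.
Variables (M : machine) (x : language).
Implicit Types (c : config M) (w gs : seq bool).

Lemma foldl_halted c gs : halted c -> foldl (step x) c gs = c.
Proof.
move=> [b hb]; elim: gs => //= g gs IH.
by rewrite {2}/step hb.
Qed.

Lemma accepting_halted c : accepting c -> halted c.
Proof. by exists true. Qed.

Lemma foldl_halted_leq c gs1 gs2 :
  halted (foldl (step x) c gs1) ->
  foldl (step x) c (gs1 ++ gs2) = foldl (step x) c gs1.
Proof. by move=> h; rewrite foldl_cat foldl_halted. Qed.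

(** A halted configuration persists, so the running time only has to be bounded
    from above. *)
Lemma poly_timeP :
  poly_time M x <-> exists k, forall w gs, (size w).+2 ^ k <= size gs ->
                                           halted (run M x w gs).
Proof.
split=> [[p Hp]|[k Hk]].
  have [k Hk] := poly_bounded_horner p; exists k => w gs le_gs.
  rewrite -(cat_take_drop p.[size w]%R gs).
  have hlt : halted (run M x w (take p.[size w]%R gs)).
    by apply: Hp; rewrite size_takel // (leq_trans (Hk _)).
  by rewrite /run foldl_halted_leq.
exists (('X + 2%:P) ^+ k)%R => w gs sz; apply: Hk.
rewrite sz horner_exp hornerD hornerX hornerC.
have -> : (size w + 2)%R = (size w).+2 by rewrite -[RHS]addn2.
suff -> : ((size w).+2 ^+ k)%R = (size w).+2 ^ k by [].
by elim: k {sz} => // k IH; rewrite GRing.exprS IH expnS.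
Qed.

(** Beyond a bound on the running time, choices can be appended to a sequence
    or cut off without changing the outcome. *)
Lemma accepts_long t w :
  (forall gs, t <= size gs -> halted (run M x w gs)) ->
  accepts M x w <-> exists gs, size gs = t /\ accepting (run M x w gs).
Proof.
move=> ht; split=> [[gs acc]|[gs [_ acc]]]; last by exists gs.
have acc' : accepting (run M x w (gs ++ nseq t false)).
  by rewrite /run foldl_halted_leq //; apply: accepting_halted.
exists (take t (gs ++ nseq t false)); split.
  by rewrite size_takel // size_cat size_nseq leq_addl.
move: acc'; rewrite -{1}(cat_take_drop t (gs ++ _)) /run foldl_halted_leq //.
by apply: ht; rewrite size_takel // size_cat size_nseq leq_addl.
Qed.

End Runs.

(** * The length of queries *)

(** The number of nonblank cells: unlike the lengths of the two stored lists, it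
    is invariant under head moves, so that it grows by at most one per step. *)
Definition marks (t : tape) : nat :=
  count isSome (tleft t) + count isSome (tright t).

Lemma count_push a s : count isSome (push a s) = isSome a + count isSome s.
Proof. by case: a => //; case: s. Qed.

Lemma count_behead (s : seq symbol) :
  isSome (head None s) + count isSome (behead s) = count isSome s.
Proof. by case: s. Qed.

Lemma marks_move d t : marks (move d t) = marks t.
Proof.
rewrite /marks; case: d => //=; rewrite count_push /scanned.
  have := count_behead (tleft t); lia.
have := count_behead (tright t); lia.
Qed.

Lemma marks_write a t : marks (write a t) <= (marks t).+1.
Proof.
rewrite /marks /= count_push; have := count_behead (tright t).
case: a (isSome _) => [a|] []; lia.
Qed.

Lemma size_tape_word t : size (tape_word t) <= marks t.
Proof.
rewrite /marks /tape_word; apply: leq_trans (leq_addl _ _).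
by elim: (tright t) => //= -[b|] s //= IH; rewrite ltnS.
Qed.

Lemma marks_step M x (c : config M) g k :
  marks (ctape (step x c g) k) <= (marks (ctape c k)).+1.
Proof.
rewrite /step; case: (program _) => [b|q1 q2|d] /=; rewrite ?leqnSn //.
by case: (d _ _) => q act /=; rewrite marks_move marks_write.
Qed.

Lemma marks_run M x w gs :
  marks (ctape (run M x w gs) (output_tape M)) <= size gs.
Proof.
elim/last_ind: gs => [|gs g IH].
  rewrite /run /= (_ : (_ == _) = false) //.
  by apply/negbTE; rewrite eq_sym input_neq_output.
by rewrite /run foldl_rcons size_rcons (leq_trans (marks_step _ _ _ _)).
Qed.

Lemma size_query M x w gs :
  size (tape_word (ctape (run M x w gs) (output_tape M))) <= size gs.
Proof. exact: leq_trans (size_tape_word _) (marks_run _ _ _ _). Qed.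

(** The query made after [i] steps has length at most [i]. *)
Lemma run_local M (x x' : language) w gs :
  (forall u, size u < size gs -> x u = x' u) ->
  run M x w gs = run M x' w gs.
Proof.
elim/last_ind: gs => [//|gs g IH] xx'; move: xx'; rewrite size_rcons => xx'.
rewrite /run !foldl_rcons -!/(run _ _ _ _) -IH; last first.
  by move=> u lt_u; rewrite xx' // ltnW.
rewrite /step; case: (program _) => // q1 q2.
by rewrite xx' // ltnS size_query.
Qed.

(** * Enumerating the machines *)

Definition direction_of (o : option bool) : direction :=
  if o is Some b then if b then GoRight else GoLeft else Stay.

Definition code_of_direction (d : direction) : option bool :=
  match d with GoLeft => Some false | Stay => None | GoRight => Some true end.

Lemma code_of_directionK : cancel code_of_direction direction_of.
Proof. by case. Qed.

(** Finite functions replace the functions on symbols, which makes this type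
    countable. *)
Definition instruction_code (n m : nat) : Type :=
  (bool + 'I_n * 'I_n +
   {ffun bool * {ffun 'I_m -> symbol} ->
         'I_n * {ffun 'I_m -> symbol * option bool}})%type.

HB.instance Definition _ n m := Countable.on (instruction_code n m).

Definition decode_instruction n m (e : instruction_code n m) :
    instruction 'I_n 'I_m :=
  match e with
  | inl (inl b) => Halt b
  | inl (inr (yes, no)) => Query yes no
  | inr d => Step (fun g r => let: (q, act) := d (g, [ffun k => r k]) in
                     (q, fun k => ((act k).1, direction_of (act k).2)))
  end.

Definition machine_code : Type :=
  {n : nat & {m : nat & ({io : 'I_m * 'I_m | io.1 != io.2} * 'I_n *
                         {ffun 'I_n -> instruction_code n m})%type}}.

HB.instance Definition _ := Countable.on machine_code.

Definition make_code n m (io : 'I_m * 'I_m) (io_neq : io.1 != io.2) (q0 : 'I_n)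
    (prog : {ffun 'I_n -> instruction_code n m}) : machine_code :=
  existT _ n (existT _ m (exist _ io io_neq, q0, prog)).

Definition decode_machine (e : machine_code) : machine :=
  let: existT n (existT m (io, q0, prog)) := e in
  @Machine 'I_n 'I_m (val io).1 (val io).2 (valP io) q0
    (fun q => decode_instruction (prog q)).

(** Agreement of all runs on the two facts about configurations that the
    complexity classes depend on. *)
Definition same_behaviour (M M' : machine) : Prop :=
  (deterministic M -> deterministic M') /\
  forall x w gs, (halted (run M x w gs) <-> halted (run M' x w gs)) /\
                 (accepting (run M x w gs) <-> accepting (run M' x w gs)).

Lemma same_behaviour_accepts M M' x w :
  same_behaviour M M' -> accepts M x w <-> accepts M' x w.
Proof. by move=> [_ H]; split=> -[gs acc]; exists gs; apply/(H x w gs).2. Qed.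

Lemma same_behaviour_poly_time M M' x :
  same_behaviour M M' -> poly_time M x <-> poly_time M' x.
Proof.
by move=> [_ H]; split=> -[p hp]; exists p => w gs sz; apply/(H x w gs).1/hp.
Qed.

Section Encoding.
Variable M : machine.
Local Notation rQ := (@enum_rank (state M)).
Local Notation rK := (@enum_rank (tape_index M)).

Definition encode_instruction (e : instruction (state M) (tape_index M)) :
    instruction_code #|state M| #|tape_index M| :=
  match e with
  | Halt b => inl (inl b)
  | Query yes no => inl (inr (rQ yes, rQ no))
  | Step d => inr [ffun gr : bool * {ffun 'I_#|tape_index M| -> symbol} =>
      let: (q, act) := d gr.1 (fun k => gr.2 (rK k)) in
      (rQ q, [ffun k => ((act (enum_val k)).1,
                         code_of_direction (act (enum_val k)).2)])]
  end.

Lemma encode_tapes_neq :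
  (rK (input_tape M), rK (output_tape M)).1 !=
  (rK (input_tape M), rK (output_tape M)).2.
Proof. by rewrite /= (inj_eq enum_rank_inj) input_neq_output. Qed.

Definition encode_machine : machine_code :=
  make_code encode_tapes_neq (rQ (start M))
    [ffun q => encode_instruction (program (enum_val q))].

Let M' := decode_machine encode_machine.

Definition encode_config (c : config M) : config M' :=
  @Config M' (rQ (cstate c)) (fun k => ctape c (enum_val k)).

Lemma program_encode q :
  program (rQ q : state M') =
  decode_instruction (encode_instruction (program q)).
Proof. by rewrite /= ffunE enum_rankK. Qed.

Lemma step_encode x c g :
  step x (encode_config c) g = encode_config (step x c g).
Proof.
rewrite /step program_encode; case: (program (cstate c)) => [b|yes no|d] //=.
  by rewrite /encode_config /= enum_rankK; case: ifP.
rewrite ffunE /=.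
set r := (fun k => _ (rK k)); set r' := (fun k => scanned (ctape c k)).
have -> : r = r' by apply/funext => k; rewrite /r ffunE /= enum_rankK.
case: (d g r') => q act; rewrite /encode_config /=; congr Config.
by apply/funext => k; rewrite ffunE /= code_of_directionK.
Qed.

Lemma run_encode x w gs : run M' x w gs = encode_config (run M x w gs).
Proof.
rewrite /run; have -> : initial M' w = encode_config (initial M w).
  rewrite /initial /encode_config /=; congr Config; apply/funext => k.
  by rewrite -(inj_eq enum_val_inj) enum_rankK.
elim: gs (initial M w) => //= g gs IH c.
by rewrite step_encode IH.
Qed.

Lemma encode_machineP : same_behaviour M M'.
Proof.
split=> [detM q d|x w gs].
  rewrite /= ffunE; move: (detM (enum_val q)).
  case: (program (enum_val q)) => //= d0 H [<-] r.
  by rewrite !ffunE /= H.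
rewrite run_encode /halted /accepting program_encode.
case: (program (cstate _)) => [b|yes no|d] /=.
- by split; [split=> _; exists b | split=> -[->]].
- by split; split=> // -[].
- by split; split=> // -[].
Qed.

End Encoding.

(** An index codes a machine together with an arbitrary number; the latter makes
    arbitrarily large indices of one machine available. *)
Lemma machine_enumeration : exists enum_machine : nat -> machine,
  forall M K, exists2 k, K <= k & same_behaviour M (enum_machine k).
Proof.
have M0 : machine.
  by refine (@Machine bool bool true false isT true (fun=> Halt true)).
exists (fun k => if (unpickle k : option (machine_code * nat)) is Some (e, _)
                 then decode_machine e else M0).
move=> M K; pose index j : nat := pickle (encode_machine M, j : nat).
have inj_index : injective index.
  by move=> i j /(pcan_inj pickleK) [].
suff [j le_j] : exists j, K <= index j.
  by exists (index j) => //; rewrite pickleK; apply: encode_machineP.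
have [//|none] := pselect (exists j, K <= index j).
have lt_index (i : 'I_K.+1) : index i < K.
  by rewrite ltnNge; apply/negP => le_i; apply: none; exists (i : nat).
have : injective (fun i => Ordinal (lt_index i)).
  by move=> i j [] /inj_index /val_inj.
by move/leq_card; rewrite !card_ord ltnn.
Qed.

(** * Measurability *)

Lemma Borel_eval (u : seq bool) (b : bool) :
  Borel_language [set x : language | x u = b].
Proof.
apply: sub_sigma_algebra.
apply: (@open_comp {ptws seq bool -> bool} bool (fun x => x u) [set b]).
  by move=> x _; apply: (@proj_continuous _ (fun=> bool) u).
exact: discrete_open.
Qed.

(** Borel sets as the measurable sets of a type, so that the closure properties
    of measurable sets apply. *)
Definition language_space := g_sigma_algebraType (@open language).

Lemma Borel0 : Borel_language set0.
Proof. exact: (@measurable0 _ language_space). Qed.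

Lemma BorelT : Borel_language setT.
Proof. exact: (@measurableT _ language_space). Qed.

Lemma BorelC A : Borel_language A -> Borel_language (~` A).
Proof. exact: (@measurableC _ language_space). Qed.

Lemma BorelU A B :
  Borel_language A -> Borel_language B -> Borel_language (A `|` B).
Proof. exact: (@measurableU _ language_space). Qed.

Lemma BorelI A B :
  Borel_language A -> Borel_language B -> Borel_language (A `&` B).
Proof. exact: (@measurableI _ language_space). Qed.

Lemma Borel_bigcup (I : countType) (A : I -> set language) :
  (forall i, Borel_language (A i)) -> Borel_language (\bigcup_i A i).
Proof. exact: (@countable_bigcupT_measurable _ language_space). Qed.

(** One step consults the oracle on at most one string, which splits the set
    into two pieces according to the answer. *)
Lemma Borel_run M (Q : config M -> Prop) c gs :
  Borel_language [set x | Q (foldl (step x) c gs)].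
Proof.
elim: gs c => [|g gs IH] c /=.
  have [hQ|hQ] := pselect (Q c).
    rewrite (_ : [set x | _] = setT); last by apply/seteqP; split.
    exact: BorelT.
  rewrite (_ : [set x | _] = set0); last by apply/seteqP; split.
  exact: Borel0.
case e : (program (cstate c)) => [b|yes no|d].
- have st x : step x c g = c by rewrite /step e.
  by under eq_set do rewrite st; exact: IH.
- set u := tape_word (ctape c (output_tape M)).
  have st x : step x c g = Config (if x u then yes else no) (ctape c).
    by rewrite /step e.
  pose after q : config M := Config q (ctape c).
  rewrite (_ : [set x | _] =
    ([set x : language | x u = true] `&`
       [set x | Q (foldl (step x) (after yes) gs)]) `|`
    ([set x : language | x u = false] `&`
       [set x | Q (foldl (step x) (after no) gs)])).
    by apply: BorelU; apply: BorelI => //; exact: Borel_eval.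
  apply/seteqP; split=> x; rewrite /= st.
    by case: (x u) => ?; [left|right].
  by case=> -[-> ?].
- have st x : step x c g = step (fun=> false) c g by rewrite /step e.
  by under eq_set do rewrite st; exact: IH.
Qed.

Lemma Borel_forall (I : countType) (A : I -> set language) :
  (forall i, Borel_language (A i)) -> Borel_language [set x | forall i, A i x].
Proof.
move=> bA; have -> : [set x | forall i, A i x] = ~` \bigcup_i ~` A i.
  rewrite setC_bigcup; apply/seteqP; split=> x h i; rewrite ?setCK.
    by move=> _; apply: h.
  by have := h i Logic.I; rewrite setCK.
by apply: BorelC; apply: Borel_bigcup => i; apply: BorelC.
Qed.

Lemma Borel_exists (I : countType) (A : I -> set language) :
  (forall i, Borel_language (A i)) -> Borel_language [set x | exists i, A i x].
Proof.
move=> bA; rewrite (_ : [set x | _] = \bigcup_i A i).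
  exact: Borel_bigcup.
by apply/seteqP; split=> x [i] /=; exists i.
Qed.

Lemma Borel_imp (A B : set language) :
  Borel_language A -> Borel_language B -> Borel_language [set x | A x -> B x].
Proof.
move=> bA bB; rewrite (_ : [set x | _] = ~` A `|` B).
  by apply: BorelU => //; apply: BorelC.
apply/seteqP; split=> x /=; last by case.
by move=> h; have [/h|] := pselect (A x); [right|left].
Qed.

Lemma Borel_and (A B : set language) :
  Borel_language A -> Borel_language B -> Borel_language [set x | A x /\ B x].
Proof. exact: BorelI. Qed.

Lemma Borel_accepts M w : Borel_language [set x | accepts M x w].
Proof.
apply: Borel_exists => gs.
exact: (Borel_run (@accepting M) (initial M w) gs).
Qed.

Lemma Borel_poly_time M : Borel_language [set x | poly_time M x].
Proof.
rewrite (_ : [set x | _] = [set x | exists k, forall w gs,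
    (size w).+2 ^ k <= size gs -> halted (run M x w gs)]); last first.
  by apply/seteqP; split=> x /= /poly_timeP.
apply: Borel_exists => k;
  apply: (Borel_forall (A := fun w => [set x | _])) => w.
apply: (Borel_forall (A := fun gs => [set x | _])) => gs.
have [le|nle] := boolP ((size w).+2 ^ k <= size gs).
  rewrite (_ : [set x | _] = [set x | halted (run M x w gs)]).
    exact: (Borel_run (@halted M) (initial M w) gs).
  by apply/seteqP; split=> x H; [apply: H | move=> _; apply: H].
by rewrite (_ : [set x | _] = setT); [exact: BorelT | apply/seteqP; split].
Qed.

(** * The equality of the two classes *)

Lemma P_sub_NP x : P_rel x `<=` NP_rel x.
Proof. by move=> L [M [_ pM HL]]; exists M. Qed.

(** Only the inclusion of the nondeterministic class in the deterministic one
    has content, and it can be stated without mentioning languages. *)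
Lemma P_eq_NPP x : P_rel x = NP_rel x <->
  forall M, poly_time M x -> exists M', [/\ deterministic M', poly_time M' x &
    forall w, accepts M x w <-> accepts M' x w].
Proof.
split=> [PNP M pM|H].
  pose L : language := fun w => `[< accepts M x w >].
  have : NP_rel x L by exists M => // w; split=> /asboolP.
  rewrite -PNP => -[M' [dM' pM' LM']]; exists M'; split=> // w.
  by rewrite -LM'; split=> /asboolP.
apply/seteqP; split=> [|L [M pM LM]]; first exact: P_sub_NP.
have [M' [dM' pM' MM']] := H M pM.
by exists M'; split=> // w; rewrite LM.
Qed.

Lemma Borel_P_eq_NP : Borel_language [set x | P_rel x = NP_rel x].
Proof.
have [enum enumP] := machine_enumeration.
(* [good i j]: machine [j] runs in polynomial time and does the work of [i]. *)
pose good i j := [set x | poly_time (enum j) x /\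
  forall w, (accepts (enum i) x w -> accepts (enum j) x w) /\
            (accepts (enum j) x w -> accepts (enum i) x w)].
rewrite (_ : [set x | _] = [set x | forall i, poly_time (enum i) x ->
    exists j, deterministic (enum j) /\ good i j x]).
  apply: (Borel_forall (A := fun i => [set x | _])) => i.
  apply: (Borel_imp (B := [set x | _]) (Borel_poly_time _)).
  apply: (Borel_exists (A := fun j => [set x | _])) => j.
  have [det|ndet] := pselect (deterministic (enum j)); last first.
    rewrite (_ : [set x | _] = set0); last by apply/seteqP; split=> x // -[].
    exact: Borel0.
  rewrite (_ : [set x | _] = good i j); last first.
    by apply/seteqP; split=> x //= -[].
  apply: (Borel_and (B := [set x | _]) (Borel_poly_time _)).
  apply: (Borel_forall (A := fun w => [set x | _])) => w.
  by apply: (Borel_and (A := [set x | _]) (B := [set x | _]));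
    apply: Borel_imp; apply: Borel_accepts.
apply/seteqP; split=> x /=.
  move=> /P_eq_NPP H i /H [M' [dM' pM' HM']].
  have [j _ sj] := enumP M' 0; exists j; split; first exact: sj.1.
  split=> [|w]; first exact: (same_behaviour_poly_time x sj).1 pM'.
  by have [ij ji] := iff_trans (HM' w) (same_behaviour_accepts x w sj); split.
move=> H; apply/P_eq_NPP => M pM.
have [i _ si] := enumP M 0.
have [j [dj [pj hj]]] := H i ((same_behaviour_poly_time x si).1 pM).
exists (enum j); split=> // w.
by apply: iff_trans (same_behaviour_accepts x w si) _; split; apply hj.
Qed.

(** * Computations that ignore the choices *)

Definition leads (M : machine) x (n : nat) (c c' : config M) : Prop :=
  forall gs, size gs = n -> foldl (step x) c gs = c'.

Section Leads.
Variables (M : machine) (x : language).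
Implicit Types c : config M.

Lemma leads0 c : leads x 0 c c.
Proof. by case. Qed.

Lemma leads1 c c' : (forall g, step x c g = c') -> leads x 1 c c'.
Proof. by move=> H [|g []] //= _. Qed.

Lemma leads_trans n m c c' c'' :
  leads x n c c' -> leads x m c' c'' -> leads x (n + m) c c''.
Proof.
move=> H1 H2 gs sz; rewrite -(cat_take_drop n gs) foldl_cat H1.
  by apply: H2; rewrite size_drop sz addKn.
by rewrite size_takel // sz leq_addr.
Qed.

Lemma leads_step n c c' c'' :
  (forall g, step x c g = c') -> leads x n c' c'' -> leads x n.+1 c c''.
Proof. by move=> /leads1; apply: leads_trans. Qed.

Lemma leads_size n c c' gs :
  halted c' -> leads x n c c' -> n <= size gs -> foldl (step x) c gs = c'.
Proof.
move=> hc' H le_n; rewrite -(cat_take_drop n gs) foldl_cat H ?size_takel //.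
exact: foldl_halted.
Qed.

End Leads.

(** * Tapes *)

(** Rewriting the scanned symbol drops a lone stored blank; this condition
    excludes it. *)
Definition trimmed (t : tape) : bool := tright t != [:: None].

Lemma write_scanned t : trimmed t -> write (scanned t) t = t.
Proof. by case: t => l [|[b|] [|a r]]. Qed.

(** * Asking the padded query *)

(** The machine below writes [0 1^((n+2)^k.+1) 0 rev(w)], where [n] is the
    length of its input [w], and accepts iff this string is in the oracle. The
    query tape is filled from right to left: the head then ends on the first
    symbol of the query, and reading [w] forwards yields its reversal. The
    exponent comes from [k.+1] nested loops, each over [n + 2] marks on its own
    counter tape. *)
Section Padding.
Variable k : nat.

Definition pad_tape := option (option 'I_k.+1).
HB.instance Definition _ := Finite.on pad_tape.
Definition pad_input : pad_tape := None.
Definition pad_output : pad_tape := Some None.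

Definition pad_state := ('I_6 + bool * 'I_k.+2)%type.
HB.instance Definition _ := Finite.on pad_state.
Definition phase i (lt_i : i < 6) : pad_state := inl (Ordinal lt_i).
Definition reading := @phase 0 isT.
Definition turning := @phase 1 isT.
Definition closing := @phase 2 isT.
Definition asking := @phase 3 isT.
Definition accepted := @phase 4 isT.
Definition rejected := @phase 5 isT.
(** Level 0 writes one symbol of padding; level [l.+1] is a loop over counter
    [l] whose body is level [l]. The loop runs leftwards over the marks, after
    which the counter is rewound to its last mark, and control passes to the
    next level, that is, back to the enclosing loop. *)
Definition level (l : nat) : pad_state := inr (false, inord l).
Definition rewinding (l : nat) : pad_state := inr (true, inord l).
Definition next_level (l : nat) : pad_state :=
  if l < k.+1 then level l.+1 else closing.

Definition acts (i o : symbol * direction) (c : nat -> symbol * direction)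
    (t : pad_tape) : symbol * direction :=
  match t with None => i | Some None => o | Some (Some j) => c j end.

Definition counter_symbol (r : pad_tape -> symbol) (j : nat) : symbol :=
  r (Some (Some (inord j))).

Definition move_counter (r : pad_tape -> symbol) (j : nat) (d : direction) :
    pad_tape -> symbol * direction :=
  acts (r pad_input, Stay) (r pad_output, Stay)
    (fun i => (counter_symbol r i, if i == j then d else Stay)).

Definition level_step (l : nat) (r : pad_tape -> symbol) :=
  if l is j.+1 then
    if counter_symbol r j is Some _ then (level j, move_counter r j GoLeft)
    else (rewinding l, move_counter r j GoRight)
  else (level 1, acts (r pad_input, Stay) (Some true, GoLeft)
                   (fun i => (counter_symbol r i, Stay))).

Definition rewind_step (l : nat) (r : pad_tape -> symbol) :=
  if counter_symbol r l.-1 is Some _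
  then (rewinding l, move_counter r l.-1 GoRight)
  else (next_level l, move_counter r l.-1 GoLeft).

(** Each symbol read also puts a mark on all counters; the end of the input and
    the state [turning] contribute two more, which keeps the base of the
    exponentiation at least 2 and leaves the heads on the last mark. *)
Definition reading_step (r : pad_tape -> symbol) :=
  if r pad_input is Some b then
    (reading, acts (Some b, GoRight) (Some b, GoLeft)
                (fun=> (Some true, GoRight)))
  else
    (turning, acts (None, Stay) (Some false, GoLeft)
                (fun=> (Some true, GoRight))).

Definition turning_step (r : pad_tape -> symbol) :=
  (level k.+1, acts (r pad_input, Stay) (r pad_output, Stay)
                 (fun=> (Some true, Stay))).

Definition closing_step (r : pad_tape -> symbol) :=
  (asking, acts (r pad_input, Stay) (Some false, Stay)
             (fun i => (counter_symbol r i, Stay))).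

Definition pad_program (q : pad_state) : instruction pad_state pad_tape :=
  match q with
  | inl i => match nat_of_ord i with
             | 0 => Step (fun=> reading_step)
             | 1 => Step (fun=> turning_step)
             | 2 => Step (fun=> closing_step)
             | 3 => Query accepted rejected
             | 4 => Halt true
             | _ => Halt false
             end
  | inr (false, l) => Step (fun=> level_step l)
  | inr (true, l) => Step (fun=> rewind_step l)
  end.

Definition pad_machine : machine :=
  @Machine pad_state pad_tape pad_input pad_output isT reading pad_program.

Lemma pad_deterministic : deterministic pad_machine.
Proof.
move=> [[[|[|[|[|[|i]]]]] lt_i]|[[] l]] d //= H r; by inversion H.
Qed.

Variable x : language.

Definition pad_config (q : pad_state) (i o : tape) (c : nat -> tape) :
    config pad_machine :=
  @Config pad_machine q
    (fun t => match t with
              | None => i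
              | Some None => o
              | Some (Some j) => c j
              end).

Definition padded (w : seq bool) : seq bool :=
  nseq ((size w).+2 ^ k.+1) true ++ false :: rev w.

Local Notation T := (Some true : symbol).

Definition output (s : seq bool) : tape := Tape [::] (None :: map some s).

(** A counter with [m] marks, on which [i] more marks are to be visited. *)
Definition counter (m i : nat) : tape :=
  if i is i'.+1 then Tape (nseq i' T) (nseq (m - i') T)
  else Tape [::] (None :: nseq m T).

Definition upd (c : nat -> tape) (j : nat) (t : tape) : nat -> tape :=
  fun i => if i == j then t else c i.

Lemma counter_symbol_config q i o c j : j < k.+1 ->
  counter_symbol (fun t => scanned (ctape (pad_config q i o c) t)) j =
  scanned (c j).
Proof. by move=> lt_j; rewrite /counter_symbol /= inordK. Qed.

(** Only the head of counter [j] moves, all other tapes being rewritten as they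
    are. *)
Lemma move_counterE q i o c j d t t' :
  trimmed i -> trimmed o -> (forall n, n != j -> trimmed (c n)) ->
  j < k.+1 ->
  move d (write (scanned t) t) = t' ->
  let cf := pad_config q i o (upd c j t) in
  let a := move_counter (fun u => scanned (ctape cf u)) j d in
  (fun u => move (a u).2 (write (a u).1 (ctape cf u))) =
  ctape (pad_config q i o (upd c j t')).
Proof.
move=> ti to tc lt_j <-; apply/funext => -[[n|]|] /=; last 2 first.
- exact: write_scanned.
- exact: write_scanned.
rewrite /counter_symbol inordK // /upd; case: eqP => [//|/eqP ne].
exact/write_scanned/tc.
Qed.

Lemma level_stepE l i o c g : l < k.+2 ->
  step x (pad_config (level l) i o c) g =
  (let t := ctape (pad_config (level l) i o c) in
   let: (q, a) := level_step l (fun u => scanned (t u)) in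
   @Config pad_machine q (fun u => move (a u).2 (write (a u).1 (t u)))).
Proof. by move=> lt_l; rewrite /step /= inordK. Qed.

Lemma rewind_stepE l i o c g : l < k.+2 ->
  step x (pad_config (rewinding l) i o c) g =
  (let t := ctape (pad_config (rewinding l) i o c) in
   let: (q, a) := rewind_step l (fun u => scanned (t u)) in
   @Config pad_machine q (fun u => move (a u).2 (write (a u).1 (t u)))).
Proof. by move=> lt_l; rewrite /step /= inordK. Qed.

Section Loops.
Variables (m : nat) (i : tape).
Hypotheses (m_gt0 : 0 < m) (ti : trimmed i).

Lemma trimmed_counter j : j <= m -> trimmed (counter m j).
Proof.
by case: j => [|j] _ /=; rewrite /trimmed /=; [case: m m_gt0|case: (m - j)].
Qed.

Lemma trimmed_output s : s != [::] -> trimmed (output s).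
Proof. by case: s. Qed.

Lemma emit_step s c : s != [::] -> (forall n, trimmed (c n)) ->
  leads x 1 (pad_config (level 0) i (output s) c)
            (pad_config (level 1) i (output (true :: s)) c).
Proof.
move=> s0 tc; apply: leads1 => g; rewrite level_stepE //=; congr Config.
apply/funext => -[[n|]|] //=; last exact: write_scanned.
by rewrite /counter_symbol inordK // write_scanned.
Qed.

Lemma level_down j s c n : j < k.+1 -> n < m -> s != [::] ->
  (forall n, trimmed (c n)) ->
  leads x 1 (pad_config (level j.+1) i (output s) (upd c j (counter m n.+1)))
            (pad_config (level j) i (output s) (upd c j (counter m n))).
Proof.
move=> lt_j lt_n s0 tc; apply: leads1 => g; rewrite level_stepE //.
rewrite /level_step counter_symbol_config // /upd eqxx /=.
have [p Ep] : exists p, m - n = p.+1 by exists (m - n).-1; lia.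
rewrite {1}/scanned /= Ep /=; congr Config.
rewrite -!/(upd _ _ _);
  apply: (move_counterE reading ti (trimmed_output s0)) => //.
rewrite /scanned /write /=.
case: n lt_n Ep => [|n] lt_n Ep /=; last by have -> : m - n = p.+2 by lia.
by rewrite subn0 in Ep; rewrite Ep.
Qed.

Lemma level_bottom j s c : j < k.+1 -> s != [::] ->
  (forall n, trimmed (c n)) ->
  leads x 1 (pad_config (level j.+1) i (output s) (upd c j (counter m 0)))
            (pad_config (rewinding j.+1) i (output s)
               (upd c j (Tape [::] (nseq m T)))).
Proof.
move=> lt_j s0 tc; apply: leads1 => g; rewrite level_stepE //.
rewrite /level_step counter_symbol_config // /upd eqxx /=.
congr Config; rewrite -!/(upd _ _ _);
  apply: (move_counterE reading ti (trimmed_output s0)) => //.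
by case: m m_gt0.
Qed.

Lemma rewind_right j s c a b : j < k.+1 -> s != [::] ->
  (forall n, trimmed (c n)) ->
  leads x b (pad_config (rewinding j.+1) i (output s)
               (upd c j (Tape (nseq a T) (nseq b T))))
            (pad_config (rewinding j.+1) i (output s)
               (upd c j (Tape (nseq (a + b) T) [::]))).
Proof.
move=> lt_j s0 tc; elim: b a => [|b IH] a; first by rewrite addn0;
  apply: leads0.
rewrite addnS -addSn; apply: leads_step (IH a.+1) => g; rewrite rewind_stepE //.
rewrite /rewind_step counter_symbol_config // /upd eqxx /=.
by congr Config; rewrite -!/(upd _ _ _);
  apply: (move_counterE reading ti (trimmed_output s0)).
Qed.

Lemma rewind_end j s c : j < k.+1 -> s != [::] ->
  (forall n, trimmed (c n)) ->
  leads x 1 (pad_config (rewinding j.+1) i (output s)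
               (upd c j (Tape (nseq m T) [::])))
            (pad_config (next_level j.+1) i (output s) (upd c j (counter m m))).
Proof.
move=> lt_j s0 tc; apply: leads1 => g; rewrite rewind_stepE //.
rewrite /rewind_step counter_symbol_config // /upd eqxx /=.
congr Config; rewrite -!/(upd _ _ _);
  apply: (move_counterE reading ti (trimmed_output s0)) => //.
by case: m m_gt0 => // m' _ /=; rewrite subSnn.
Qed.

Fixpoint loop_cost (l : nat) : nat :=
  if l is l'.+1 then m * (loop_cost l').+1 + (m + 2) else 1.

(** Started with its counters at their last marks, a level writes [m ^ l]
    symbols and restores these counters; each of the [m] passes of a loop runs
    the body once. *)
Lemma loop_run l s c : l < k.+2 -> s != [::] -> (forall n, trimmed (c n)) ->
  (forall j, j < l -> c j = counter m m) ->
  leads x (loop_cost l) (pad_config (level l) i (output s) c)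
          (pad_config (next_level l) i (output (nseq (m ^ l) true ++ s)) c).
Proof.
elim: l s c => [|l IH] s c lt_l s0 tc home.
  by rewrite expn0 /next_level; apply: emit_step.
have lt_l' : l < k.+1 by [].
have upd_home : upd c l (counter m m) = c.
  by apply/funext => n; rewrite /upd; case: eqP => [->|//]; rewrite home.
have tupd n j : n <= m -> trimmed (upd c l (counter m n) j).
  by move=> le_n; rewrite /upd; case: eqP => // _; apply: trimmed_counter.
have visit n : n <= m ->
    leads x (n * (loop_cost l).+1)
      (pad_config (level l.+1) i (output s) (upd c l (counter m n)))
      (pad_config (level l.+1) i (output (nseq (n * m ^ l) true ++ s))
         (upd c l (counter m 0))).
  elim: n s s0 => [|n IHn] s s0 le_n; first exact: leads0.
  have sn : nseq (m ^ l) true ++ s != [::].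
    by case: (nseq _ _).
  rewrite mulSn addSn -{1}(addn0 (loop_cost l)) addn0.
  have down := level_down lt_l' le_n s0 tc.
  have home' j : j < l -> upd c l (counter m n) j = counter m m.
    by move=> lt_j; rewrite /upd ltn_eqF // home // ltnW.
  have inner := IH s _ (ltnW lt_l) s0 (fun j => tupd n j (ltnW le_n)) home'.
  have := leads_trans (leads_trans down inner).
  rewrite /next_level lt_l' => /(_ _ _ (IHn _ sn (ltnW le_n))).
  by rewrite catA -nseqD -mulSnr; apply.
have {}visit := visit m (leqnn m); rewrite upd_home -expnS in visit.
have sn : nseq (m ^ l.+1) true ++ s != [::] by case: (nseq _ _).
have := leads_trans visit (leads_trans (level_bottom lt_l' sn tc)
  (leads_trans (rewind_right 0 (b := m) lt_l' sn tc) (rewind_end lt_l' sn tc))).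
by rewrite upd_home (_ : 1 + (m + 1) = m + 2) //; lia.
Qed.

End Loops.

Lemma reading_run w n s l :
  leads x (size w)
    (pad_config reading (Tape l (map some w))
       (Tape [::] (push None (map some s))) (fun=> Tape (nseq n T) [::]))
    (pad_config reading (Tape (catrev (map some w) l) [::])
       (Tape [::] (push None (map some (catrev w s))))
       (fun=> Tape (nseq (n + size w) T) [::])).
Proof.
elim: w n s l => [|b w IH] n s l; first by rewrite addn0; apply: leads0.
rewrite /= addnS -addSn.
apply: leads_step (IH n.+1 (b :: s) (Some b :: l)) => g.
rewrite /step /=; congr Config; apply/funext => -[[j|]|] //=.
by case: s.
Qed.

Lemma turning_run n s l :
  leads x 2
    (pad_config reading (Tape l [::]) (Tape [::] (push None (map some s)))
       (fun=> Tape (nseq n T) [::]))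
    (pad_config (level k.+1) (Tape l [::]) (output (false :: s))
       (fun=> counter n.+2 n.+2)).
Proof.
apply: (@leads_step _ _ _ _ (pad_config turning (Tape l [::])
  (output (false :: s)) (fun=> Tape (nseq n.+1 T) [::]))).
  move=> g; rewrite /step /=; congr Config; apply/funext => -[[j|]|] //=.
  by case: s.
apply: leads1 => g; rewrite /step /=; congr Config.
by apply/funext => -[[j|]|] //=; rewrite subSnn.
Qed.

Definition pad_answer (s : seq bool) : pad_state :=
  if x (false :: s) then accepted else rejected.

Lemma closing_run s l c : s != [::] -> (forall n, trimmed (c n)) ->
  leads x 2
    (pad_config closing (Tape l [::]) (output s) c)
    (pad_config (pad_answer s) (Tape l [::])
       (Tape [::] (map some (false :: s))) c).
Proof.
move=> s0 tc.
apply: (@leads_step _ _ _ _ (pad_config asking (Tape l [::])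
  (Tape [::] (map some (false :: s))) c)).
  move=> g; rewrite /step /=; congr Config; apply/funext => -[[j|]|] //=.
  by rewrite /counter_symbol inord_val write_scanned.
apply: leads1 => g; rewrite /step /=; congr Config.
rewrite /pad_answer /tape_word /=;
  suff -> : bits_before_blank (map some s) = s by [].
by elim: (s) => //= b s' ->.
Qed.

Definition pad_cost (n : nat) : nat := n + (2 + (loop_cost n.+2 k.+1 + 2)).

Lemma pad_run w : exists i o c,
  leads x (pad_cost (size w)) (initial pad_machine w)
    (pad_config (pad_answer (padded w)) i o c).
Proof.
set l := catrev (map some w) [::]; set m := (size w).+2.
pose s := false :: rev w.
exists (Tape l [::]), (Tape [::] (map some (false :: padded w))),
  (fun=> counter m m).
have -> : initial pad_machine w = pad_config reading (Tape [::] (map some w))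
   (Tape [::] (push None (map some [::]))) (fun=> Tape (nseq 0 T) [::]).
  by rewrite /initial; congr Config; apply/funext => -[[j|]|].
have tc (n : nat) : trimmed (counter m m) by apply: trimmed_counter.
have p0 : padded w != [::] by rewrite /padded; case: (nseq _ _).
rewrite /pad_cost.
refine (leads_trans (@reading_run w 0 [::] [::]) _); rewrite add0n.
refine (leads_trans (@turning_run _ _ _) _).
refine (leads_trans _ (closing_run l p0 tc)).
have -> : closing = next_level k.+1 by rewrite /next_level ltnn.
by apply: loop_run.
Qed.

Lemma pad_run_halted w gs : pad_cost (size w) <= size gs ->
  halted (run pad_machine x w gs) /\
  (accepting (run pad_machine x w gs) <-> x (false :: padded w)).
Proof.
have [i [o [c H]]] := pad_run w => le_gs.
have hh : halted (pad_config (pad_answer (padded w)) i o c).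
  by rewrite /halted /= /pad_answer; case: ifP; eexists.
rewrite /run (leads_size hh H le_gs); split=> //.
by rewrite /accepting /= /pad_answer; case: ifP.
Qed.

Lemma pad_poly_time : poly_time pad_machine x.
Proof.
have [d hd] : poly_bounded pad_cost.
  apply: poly_bounded_add poly_bounded_id _.
  apply: poly_bounded_add (poly_bounded_const 2) _.
  apply: poly_bounded_add _ (poly_bounded_const 2).
  have pm : poly_bounded (fun n => n.+2) by exists 1.
  elim: k.+1 => [|l IH] /=; first exact: poly_bounded_const.
  apply: poly_bounded_add.
    apply: poly_bounded_mul pm _; under eq_fun do rewrite -addn1.
    exact: poly_bounded_add IH (poly_bounded_const 1).
  exact: poly_bounded_add pm (poly_bounded_const 2).
apply/poly_timeP; exists d => w gs le_gs.
exact: (pad_run_halted (leq_trans (hd _) le_gs)).1.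
Qed.

Lemma pad_accepts w : accepts pad_machine x w <-> x (false :: padded w).
Proof.
have long gs := @pad_run_halted w gs.
rewrite (accepts_long (fun gs le_gs => (long gs le_gs).1)).
split=> [[gs [sz acc]]|xw]; first by apply/(long gs _).2 => //; rewrite sz.
exists (nseq (pad_cost (size w)) false); rewrite size_nseq; split=> //.
by apply/(long _ _).2 => //; rewrite size_nseq.
Qed.

End Padding.

(** The padded word determines the word and the exponent. *)
Lemma padded_inj k k' w w' : padded k w = padded k' w' -> k = k' /\ w = w'.
Proof.
rewrite /padded => E.
have idx n (s : seq bool) : index false (nseq n true ++ false :: s) = n.
  by elim: n => //= n ->.
have En : (size w).+2 ^ k.+1 = (size w').+2 ^ k'.+1.
  by have := congr1 (index false) E; rewrite !idx.
move/eqP: E;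
  rewrite eqseq_cat ?size_nseq // => /andP[_ /eqP[/(can_inj revK) Ew]].
by split=> //; move: En; rewrite Ew => /expnI -/(_ isT) [].
Qed.

(** * The strategy *)

(** The strategy puts a padded word in [x] iff the machine coded by the exponent
    accepts it along a sequence of choices as long as the padding. *)
Lemma winning_strategy :
  exists sigma, winningI [set x | P_rel x = NP_rel x] sigma.
Proof.
have [enum enumP] := machine_enumeration.
pose sigma : strategyI := fun _ h s => `[< exists k w gs,
  [/\ s = padded k w, size gs = (size w).+2 ^ k.+1 &
      accepting (run (enum k) h w gs)] >].
exists sigma => y z fol; set x := join y z.
have yP k w : x (false :: padded k w) <-> exists gs,
    size gs = (size w).+2 ^ k.+1 /\ accepting (run (enum k) x w gs).
  have loc gs : size gs = (size w).+2 ^ k.+1 ->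
      run (enum k) (position (size (padded k w)).+1 x) w gs =
      run (enum k) x w gs.
    move=> sz; apply: run_local => u lt_u; rewrite /position.
    rewrite (_ : _ < _) // (ltn_trans lt_u) // sz /padded size_cat size_nseq /=.
    by rewrite ltnS leq_addr.
  rewrite /x /= (fol _ _ erefl) -/x; split.
    move/asboolP => [k' [w' [gs [/padded_inj [<- <-] sz acc]]]].
    by exists gs; split=> //; rewrite -loc.
  move=> [gs [sz acc]]; apply/asboolP; exists k, w, gs; split=> //.
  by rewrite loc.
apply/P_eq_NPP => M pM.
have [d hd] := (poly_timeP M x).1 pM.
have [k le_dk sk] := enumP M d.
exists (pad_machine k); split.
- exact: pad_deterministic.
- exact: pad_poly_time.
move=> w; apply: iff_trans (same_behaviour_accepts x w sk) _.
apply: iff_trans (iff_sym (pad_accepts k x w)).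
apply: iff_trans (iff_sym (yP k w)).
apply: accepts_long => gs le_gs; apply/(sk.2 x w gs).1/hd.
by apply: leq_trans le_gs; apply: leq_exp2; apply: leqW.
Qed.

(** * Tapes reached by a computation *)

Definition neat_seq (s : seq symbol) : bool := last (Some true) s != None.
Definition neat (t : tape) : bool := neat_seq (tleft t) && neat_seq (tright t).

Lemma neat_push a s : neat_seq s -> neat_seq (push a s).
Proof. by case: a s => [a|] []. Qed.

Lemma neat_behead s : neat_seq s -> neat_seq (behead s).
Proof. by case: s => [|a [|b s]]. Qed.

Lemma neat_write a t : neat t -> neat (write a t).
Proof. by move=> /andP[nl nr]; rewrite /neat nl neat_push ?neat_behead. Qed.

Lemma neat_move d t : neat t -> neat (move d t).
Proof.
by move=> /andP[nl nr]; rewrite /neat; case: d;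
  rewrite /= ?nl ?nr ?neat_push ?neat_behead.
Qed.

Lemma neat_trimmed t : neat t -> trimmed t.
Proof. by case: t => l [|[b|] [|a r]] // /andP[]. Qed.

(** Reachable tapes never store a trailing blank, so rewriting the scanned
    symbol leaves them unchanged. *)
Lemma neat_run M x w gs k : neat (ctape (run M x w gs) k).
Proof.
elim/last_ind: gs k => [|gs g IH] k.
  rewrite /run /=; case: ifP => // _; rewrite /neat /neat_seq /=.
  by case/lastP: w => // w b; rewrite map_rcons last_rcons.
rewrite /run foldl_rcons -/(run _ _ _ _) /step.
case: (program _) => [b|q1 q2|d]; try exact: IH.
by case: (d _ _) => q act /=; apply/neat_move/neat_write.
Qed.

Lemma tape_word_write_scanned t : tape_word (write (scanned t) t) = tape_word t.
Proof. by case: t => l [|[b|] [|a r]]. Qed.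

Lemma size_push a s : size (push a s) <= (size s).+1.
Proof. by case: a s => [a|] []. Qed.

(** Symbols may follow the blank that ends the word on a tape. *)
Lemma tape_wordE t : neat t -> exists2 r,
  tright t = map some (tape_word t) ++ r & head None r = None /\ r != [:: None].
Proof.
case: t => l r /andP[_]; rewrite /tape_word /=.
elim: r => [|[b|] r IH] nr; first by exists [::].
  have [|r' E P] := IH; first exact: neat_behead nr.
  by exists r'; rewrite //= -E.
by exists (None :: r) => //; split=> //; case: r nr {IH}.
Qed.

(** * Answering the queries of a machine by a reduction *)

(** The machine [comp_machine] imitates [M]; at a query it copies the string to
    the input tape of [F], runs [F], queries the value computed by [F] and
    erases the tapes of [F].  The targets of the query of [M] are remembered in
    the state. *)

Section Composition.
Variables M F : machine.
Hypothesis freeF : oracle_free F.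
Local Notation Q := (state M).
Local Notation K := (tape_index M).
Local Notation KF := (tape_index F).
Local Notation oM := (output_tape M).
Local Notation iF := (input_tape F).
Local Notation T := (Some true : symbol).

(** The tape [inr (k, false)] is the tape [k] of [F]; on [inr (k, true)] the
    cells visited on that tape are marked. *)
Definition comp_tape := (K + KF * bool)%type.
HB.instance Definition _ := Finite.on comp_tape.

Definition comp_state := (Q + (Q * Q) * ('I_3 + state F) + bool * Q)%type.
HB.instance Definition _ := Finite.on comp_state.

Definition simulating q : comp_state := inl (inl q).
Definition copying (yn : Q * Q) : comp_state :=
  inl (inr (yn, inl (@Ordinal 3 0 isT))).
Definition returning (yn : Q * Q) : comp_state :=
  inl (inr (yn, inl (@Ordinal 3 1 isT))).
Definition forwarding (yn : Q * Q) : comp_state :=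
  inl (inr (yn, inl (@Ordinal 3 2 isT))).
Definition computing (yn : Q * Q) (q : state F) : comp_state :=
  inl (inr (yn, inr q)).
Definition spreading (q : Q) : comp_state := inr (false, q).
Definition wiping (q : Q) : comp_state := inr (true, q).

Definition by_part (A : Type) (m : K -> A) (d s : KF -> A)
    (t : comp_tape) : A :=
  match t with
  | inl k => m k
  | inr (k, false) => d k
  | inr (k, true) => s k
  end.

Definition stay (J : Type) (r : J -> symbol) (k : J) : symbol * direction :=
  (r k, Stay).
Definition go (J : eqType) (j : J) (d : direction) (r : J -> symbol) (k : J) :
    symbol * direction :=
  (r k, if k == j then d else Stay).
Definition put (j : KF) (b : bool) (r : KF -> symbol) (k : KF) :
    symbol * direction :=
  if k == j then (Some b, GoRight) else (r k, Stay).

Definition part_m (r : comp_tape -> symbol) (k : K) := r (inl k).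
Definition part_d (r : comp_tape -> symbol) (k : KF) := r (inr (k, false)).
Definition part_s (r : comp_tape -> symbol) (k : KF) := r (inr (k, true)).

(** The word is copied to the right of the start of the input tape of [F]. *)
Definition copying_step yn (r : comp_tape -> symbol) :=
  if part_m r oM is Some b then
    (copying yn, by_part (go oM GoRight (part_m r)) (put iF b (part_d r))
                         (put iF true (part_s r)))
  else
    (returning yn, by_part (stay (part_m r)) (go iF GoLeft (part_d r))
                           (go iF GoLeft (part_s r))).

(** The two heads go back together.  The head on the input tape of [F] started
    its way back one step earlier, so it reaches the blank to the left of the
    copy when the head of [M] is where it was at the query. *)
Definition returning_step yn (r : comp_tape -> symbol) :=
  if part_d r iF is Some _ then
    (returning yn, by_part (go oM GoLeft (part_m r)) (go iF GoLeft (part_d r))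
                           (go iF GoLeft (part_s r)))
  else
    (computing yn (start F),
     by_part (stay (part_m r)) (go iF GoRight (part_d r))
             (go iF GoRight (part_s r))).

(** All heads go to the right end of the marked area of their tapes, wait there
    for each other, and [wiping_step] then erases from right to left. *)
Definition spreading_step q (r : comp_tape -> symbol) :=
  if [exists k, part_s r k != None] then
    let d k := if part_s r k == None then Stay else GoRight in
    (spreading q, by_part (stay (part_m r)) (fun k => (None, d k))
                          (fun k => (part_s r k, d k)))
  else
    (wiping q, by_part (stay (part_m r)) (fun=> (None, GoLeft))
                       (fun k => (part_s r k, GoLeft))).

Definition wiping_step q (r : comp_tape -> symbol) :=
  if [exists k, part_s r k != None] then
    let d k := if part_s r k == None then Stay else GoLeft in
    (wiping q, by_part (stay (part_m r)) (fun k => (None, d k))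
                       (fun k => (None, d k)))
  else
    (simulating q,
     by_part (stay (part_m r)) (stay (part_d r)) (stay (part_s r))).

Definition simulating_step (q : Q) : instruction comp_state comp_tape :=
  match program q with
  | Halt b => Halt b
  | Query yes no => Step (fun _ r =>
      (copying (yes, no),
       by_part (stay (part_m r)) (stay (part_d r)) (stay (part_s r))))
  | Step d => Step (fun g r =>
      let: (q', a) := d g (part_m r) in
      (simulating q', by_part a (stay (part_d r)) (stay (part_s r))))
  end.

(** The cells scanned when [F] halts are marked on the way to the state
    [forwarding]; all other visited cells are marked already. *)
Definition computing_step yn (q : state F) : instruction comp_state comp_tape :=
  match program q with
  | Halt _ => Step (fun _ r =>
      (forwarding yn,
       by_part (stay (part_m r)) (stay (part_d r)) (fun=> (T, Stay))))
  | Query _ _ => Halt false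
  | Step d => Step (fun _ r =>
      let: (q', a) := d false (part_d r) in
      (computing yn q',
       by_part (stay (part_m r)) a (fun k => (T, (a k).2))))
  end.

Definition comp_program (q : comp_state) : instruction comp_state comp_tape :=
  match q with
  | inl (inl q) => simulating_step q
  | inl (inr (yn, inl i)) =>
      match nat_of_ord i with
      | 0 => Step (fun=> copying_step yn)
      | 1 => Step (fun=> returning_step yn)
      | _ => Query (spreading yn.1) (spreading yn.2)
      end
  | inl (inr (yn, inr q)) => computing_step yn q
  | inr (false, q) => Step (fun=> spreading_step q)
  | inr (true, q) => Step (fun=> wiping_step q)
  end.

Definition comp_machine : machine :=
  @Machine comp_state comp_tape
    (inl (input_tape M)) (inr (output_tape F, false)) isT
    (simulating (start M)) comp_program.

Lemma comp_deterministic : deterministic M -> deterministic comp_machine.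
Proof.
move=> detM [[q|[yn [[[|[|i]] lt_i]|q]]]|[[] q]] d /=.
- rewrite /simulating_step; case E: (program q) => [b|yes no|d'] //= [<-] // r.
  by rewrite (detM _ _ E).
- by case=> <-.
- by case=> <-.
- by [].
- by rewrite /computing_step; case E: (program q) => [b|yes no|d'] //= [<-].
- by case=> <-.
- by case=> <-.
Qed.

Variable y : language.

Definition comp_config (q : comp_state) (m : K -> tape) (d s : KF -> tape) :
    config comp_machine :=
  @Config comp_machine q (by_part m d s).

Definition apply_acts (J : Type) (a : J -> symbol * direction) (t : J -> tape) :
    J -> tape :=
  fun k => move (a k).2 (write (a k).1 (t k)).

Definition scan (J : Type) (t : J -> tape) (k : J) : symbol := scanned (t k).

Lemma comp_step_acts q m d s e g q' am ad' as' m' d' s' :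
  comp_program q = Step e ->
  e g (by_part (scan m) (scan d) (scan s)) = (q', by_part am ad' as') ->
  apply_acts am m = m' -> apply_acts ad' d = d' -> apply_acts as' s = s' ->
  step y (comp_config q m d s) g = comp_config q' m' d' s'.
Proof.
move=> Eq Ee <- <- <-; rewrite /step /= Eq.
have -> : (fun k => scanned (by_part m d s k)) =
          by_part (scan m) (scan d) (scan s).
  by apply/funext => -[k|[k []]].
by rewrite Ee; congr Config; apply/funext => -[k|[k []]].
Qed.

Lemma apply_stay (J : Type) (t : J -> tape) :
  (forall k, trimmed (t k)) -> apply_acts (stay (scan t)) t = t.
Proof. by move=> tt; apply/funext => k; apply: write_scanned. Qed.

Lemma apply_stay_blank (J : Type) :
  apply_acts (stay (scan (fun=> blank_tape))) (fun=> blank_tape) =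
  (fun=> blank_tape) :> (J -> tape).
Proof. exact: apply_stay. Qed.

Definition upd_at (J : eqType) (t : J -> tape) (j : J) (u : tape) : J -> tape :=
  fun k => if k == j then u else t k.

Lemma apply_go (J : eqType) (t : J -> tape) j dir u :
  (forall k, k != j -> trimmed (t k)) ->
  apply_acts (go j dir (scan (upd_at t j u))) (upd_at t j u) =
  upd_at t j (move dir (write (scanned u) u)).
Proof.
move=> tt; apply/funext => k; rewrite /apply_acts /go /scan /upd_at /=.
by case: eqP => // /eqP ne; apply/write_scanned/tt.
Qed.

Lemma apply_put (j : KF) b u :
  apply_acts (put j b (scan (upd_at (fun=> blank_tape) j u)))
    (upd_at (fun=> blank_tape) j u) =
  upd_at (fun=> blank_tape) j (move GoRight (write (Some b) u)).
Proof.
apply/funext => k; rewrite /apply_acts /put /scan /upd_at /=.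
by case: eqP.
Qed.

(** ** Copying the query *)

Section Copy.
Variables (m : K -> tape) (yn : Q * Q) (l r : seq symbol).
Hypotheses (tm : forall k, trimmed (m k)) (hr : head None r = None)
           (tr : r != [:: None]).
Local Notation onF := (upd_at (fun=> blank_tape) iF).

Lemma trimmed_onM v u : trimmed (Tape u (map some v ++ r)).
Proof. by case: v => [|b [|b' v]]. Qed.

(** Here [u] is the part of the word already copied, reversed, and [v] the
    rest. *)
Lemma copy_run v u :
  leads y (size v)
    (comp_config (copying yn)
       (upd_at m oM (Tape (map some u ++ l) (map some v ++ r)))
       (onF (Tape (map some u) [::])) (onF (Tape (nseq (size u) T) [::])))
    (comp_config (copying yn)
       (upd_at m oM (Tape (map some (catrev v u) ++ l) r))
       (onF (Tape (map some (catrev v u)) [::]))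
       (onF (Tape (nseq (size (catrev v u)) T) [::]))).
Proof.
elim: v u => [|b v IH] u; first exact: leads0.
apply: leads_step (IH (b :: u)) => g; eapply comp_step_acts.
- reflexivity.
- by rewrite /copying_step {1}/part_m /= {1}/scan /upd_at eqxx; reflexivity.
- by rewrite apply_go //= /write /= (_ : push _ _ = Some b :: map some v ++ r).
- by rewrite apply_put.
- by rewrite apply_put.
Qed.

Lemma turn_run v :
  leads y 1
    (comp_config (copying yn)
       (upd_at m oM (Tape (map some v ++ l) r))
       (onF (Tape (map some v) [::])) (onF (Tape (nseq (size v) T) [::])))
    (comp_config (returning yn)
       (upd_at m oM (Tape (map some v ++ l) r))
       (onF (move GoLeft (Tape (map some v) [::])))
       (onF (move GoLeft (Tape (nseq (size v) T) [::])))).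
Proof.
apply: leads1 => g; eapply comp_step_acts.
- reflexivity.
- by rewrite /copying_step {1}/part_m /= {1}/scan /upd_at eqxx /scanned /= hr;
    reflexivity.
- rewrite apply_stay // => k.
  by rewrite /upd_at; case: eqP => // _; apply: (trimmed_onM [::]).
- by rewrite apply_go.
- by rewrite apply_go.
Qed.

(** Here [v] is the part of the word still to be passed, reversed, and [u] the
    rest;
      the head on the tape of [F] is one cell to the left of the boundary. *)
Lemma return_run v u :
  leads y (size v)
    (comp_config (returning yn)
       (upd_at m oM (Tape (map some v ++ l) (map some u ++ r)))
       (onF (move GoLeft (Tape (map some v) (map some u))))
       (onF (move GoLeft (Tape (nseq (size v) T) (nseq (size u) T)))))
    (comp_config (returning yn)
       (upd_at m oM (Tape l (map some (catrev v u) ++ r)))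
       (onF (move GoLeft (Tape [::] (map some (catrev v u)))))
       (onF (move GoLeft (Tape [::] (nseq (size (catrev v u)) T))))).
Proof.
elim: v u => [|b v IH] u; first exact: leads0.
apply: leads_step (IH (b :: u)) => g; eapply comp_step_acts.
- reflexivity.
- by rewrite /returning_step {1}/part_d /= {1}/scan /upd_at eqxx; reflexivity.
- by rewrite apply_go // write_scanned ?trimmed_onM.
- by rewrite apply_go.
- by rewrite apply_go.
Qed.

Lemma begin_run u :
  leads y 1
    (comp_config (returning yn) (upd_at m oM (Tape l (map some u ++ r)))
       (onF (move GoLeft (Tape [::] (map some u))))
       (onF (move GoLeft (Tape [::] (nseq (size u) T)))))
    (comp_config (computing yn (start F))
       (upd_at m oM (Tape l (map some u ++ r)))
       (onF (Tape [::] (map some u))) (onF (Tape [::] (nseq (size u) T)))).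
Proof.
apply: leads1 => g; eapply comp_step_acts.
- reflexivity.
- rewrite /returning_step {1}/part_d /= {1}/scan /upd_at eqxx.
  by rewrite (_ : scanned _ = None); [reflexivity | case: (u)].
- rewrite apply_stay // => k.
  by rewrite /upd_at; case: eqP => // _; apply: trimmed_onM.
- by rewrite apply_go //; case: (u).
- by rewrite apply_go //; case: (u).
Qed.

End Copy.

(** ** Running the reduction and erasing its tapes *)

Section Compute.
Variables (m : K -> tape) (yn : Q * Q).
Hypothesis tm : forall k, trimmed (m k).

(** [u] marks at least the cells in use on [t], except possibly the scanned
    one, and at most [n] cells besides it. *)
Definition shadowed (n : nat) (t u : tape) : Prop :=
  exists a b, [/\ tleft u = nseq a T, behead (tright u) = nseq b T,
                  size (tleft t) <= a, size (tright t) <= b.+1 & a + b <= n].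

Lemma shadowed_step n t u a d : shadowed n t u ->
  shadowed n.+1 (move d (write a t)) (move d (write T u)).
Proof.
case: t u => l r [l' r'] [p [q [/= -> Er' sl sr pq]]].
have sz : size (push a (behead r)) <= q.+1.
  by apply: leq_trans (size_push _ _) _; rewrite size_behead; lia.
case: d; rewrite /write /move /= Er'.
- exists p.-1, q.+1; split=> /=.
  + by case: (p).
  + by case: (p).
  + by rewrite size_behead; lia.
  + by apply: leq_trans (size_push _ _) _.
  + by lia.
- exists p, q; split=> //=; lia.
- exists p.+1, q.-1; split=> /=.
  + by [].
  + by case: (q).
  + by apply: leq_trans (size_push _ _) _.
  + by rewrite size_behead; lia.
  + by lia.
Qed.

(** Since [F] makes no queries, running it with the empty oracle is the same as
    running it inside the machine that has oracle [y]. *)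
Lemma compute_run n N (c : config F) u :
  (forall k, shadowed N (ctape c k) (u k)) ->
  halted (foldl (step (fun=> false)) c (nseq n false)) ->
  let c' := foldl (step (fun=> false)) c (nseq n false) in
  exists n' u', [/\ n' <= n,
    forall k, shadowed (N + n) (ctape c' k) (u' k) &
    leads y n' (comp_config (computing yn (cstate c)) m (ctape c) u)
               (comp_config (computing yn (cstate c')) m (ctape c') u')].
Proof.
elim: n N c u => [|n IH] N c u sh hc.
  by exists 0, u; split=> //; [rewrite addn0 | apply: leads0].
have [hlt|nhlt] := pselect (halted c).
  exists 0, u; rewrite foldl_halted //; split=> //; last exact: leads0.
  move=> k; have [p [q [? ? ? ? pq]]] := sh k.
  by exists p, q; split=> //; apply: leq_trans pq (leq_addr _ _).
case E : (program (cstate c)) => [b|q1 q2|d]; first by case: nhlt; exists b.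
  by case: (freeF E).
pose c1 := step (fun=> false) c false.
case Ed : (d false (fun k => scanned (ctape c k))) => [q' a].
have c1E : c1 = Config q' (apply_acts a (ctape c)) by rewrite /c1 /step E Ed.
pose u1 : KF -> tape := apply_acts (fun k => (T, (a k).2)) u.
have sh1 k : shadowed N.+1 (ctape c1 k) (u1 k).
  by rewrite c1E; apply: shadowed_step.
have [n' [u' [le_n sh' H]]] := IH N.+1 c1 u1 sh1 hc.
exists n'.+1, u'; split=> //; first by move=> k; rewrite addnS -addSn.
apply: leads_step H => g; rewrite c1E; eapply comp_step_acts.
- by rewrite /= /computing_step E; reflexivity.
- by rewrite /= -[part_d _]/(fun k => scanned (ctape c k)) Ed; reflexivity.
- by rewrite apply_stay.
- by [].
- by [].
Qed.

(** As [shadowed], but with the scanned cell marked too: the marks form an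
    interval that contains the head and all cells in use. *)
Definition covered (n : nat) (t u : tape) : Prop :=
  exists a b, [/\ u = Tape (nseq a T) (nseq b T), 0 < a + b,
                  size (tleft t) <= a, size (tright t) <= b & a + b <= n].

Lemma mark_run N q b t u : program q = Halt b ->
  (forall k, shadowed N (t k) (u k)) ->
  exists u', (forall k, covered N.+1 (apply_acts (stay (scan t)) t k) (u' k)) /\
    leads y 1 (comp_config (computing yn q) m t u)
      (comp_config (forwarding yn) m (apply_acts (stay (scan t)) t) u').
Proof.
move=> Eq sh; exists (apply_acts (fun=> (T, Stay)) u); split=> [k|].
  have [p [r [Ep Er sl sr pr]]] := sh k; exists p, r.+1.
  rewrite /apply_acts /write /= Ep Er; split=> //; try lia.
  rewrite /stay /scan /scanned /=; case: (tright (t k)) sr => //= a s.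
  by rewrite /push; case: ifP => //=; rewrite ltnS.
apply: leads1 => g; eapply comp_step_acts.
- by rewrite /= /computing_step Eq; reflexivity.
- by reflexivity.
- by rewrite apply_stay.
- by [].
- by [].
Qed.

Lemma forward_run t u :
  leads y 1 (comp_config (forwarding yn) m t u)
    (comp_config
       (spreading (if y (tape_word (t (output_tape F))) then yn.1 else yn.2))
       m t u).
Proof. by apply: leads1 => g; rewrite /step /=; case: ifP. Qed.

(** What [wiping_step] finds on a pair of tapes: the heads are on the last mark,
    or the erasure is complete. *)
Definition erasable (n : nat) (t u : tape) : Prop :=
  (t = blank_tape /\ u = blank_tape) \/
  exists a, [/\ u = Tape (nseq a T) [:: T], a < n,
                size (tleft t) <= a & size (tright t) <= 1].

(** The tapes whose erasure is complete wait for the others; blank tapes have a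
    single representation, so the configuration before the query of [F] is
    restored exactly. *)
Lemma wipe_run n q t u : (forall k, erasable n (t k) (u k)) ->
  exists n', n' <= n.+1 /\
    leads y n' (comp_config (wiping q) m t u)
      (comp_config (simulating q) m (fun=> blank_tape) (fun=> blank_tape)).
Proof.
elim: n t u => [|n IH] t u er.
  exists 1; split=> //.
  have -> : t = fun=> blank_tape by apply/funext => k;
    case: (er k) => -[] // ? [].
  have -> : u = fun=> blank_tape by apply/funext => k;
    case: (er k) => -[] // ? [].
  apply: leads1 => g; eapply comp_step_acts.
  - by reflexivity.
  - rewrite /wiping_step ifF; first by reflexivity.
    by apply/negbTE/existsP => -[k].
  - by rewrite apply_stay.
  - by rewrite apply_stay_blank.
  - by rewrite apply_stay_blank.
have [/existsP ex|/existsP nex] := boolP [exists k, scan u k != None];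
  last first.
  have [] := IH t u; last by move=> n' [le_n' H]; exists n'; split=> //;
    apply: leqW.
  move=> k; case: (er k) => [|[a [Eu _ _ _]]]; first by left.
  by case: nex; exists k; rewrite /scan Eu.
pose d k := if scan u k == None then Stay else GoLeft.
have [] := IH (apply_acts (fun k => (None, d k)) t)
    (apply_acts (fun k => (None, d k)) u).
  move=> k; rewrite /apply_acts /d /scan /=.
  case: (er k) => [[-> ->]|[a [-> lt_a sl sr]]]; first by left.
  have Er : behead (tright (t k)) = [::] by case: (tright _) sr => // ? [].
  rewrite /write /= Er; case: a sl lt_a => [|a] sl lt_a.
    by left; case: (tleft (t k)) sl.
  right; exists a; split=> //=; first by rewrite size_behead; lia.
  exact: size_push.
move=> n' [le_n' H]; exists n'.+1; split=> //.
apply: leads_step H => g; eapply comp_step_acts.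
- by reflexivity.
- rewrite /wiping_step ifT; first by reflexivity.
  by apply/existsP.
- by rewrite apply_stay.
- by [].
- by [].
Qed.

Lemma spread_run n N q t u :
  (forall k, exists a b, [/\ u k = Tape (nseq a T) (nseq b T), 0 < a + b,
    size (tleft (t k)) <= a, size (tright (t k)) <= b &
    a + b <= N /\ b <= n]) ->
  exists n' t' u', [/\ n' <= n.+1, forall k, erasable N (t' k) (u' k) &
    leads y n' (comp_config (spreading q) m t u)
               (comp_config (wiping q) m t' u')].
Proof.
elim: n t u => [|n IH] t u sp.
  exists 1, (apply_acts (fun=> (None, GoLeft)) t),
    (apply_acts (fun k => (scan u k, GoLeft)) u).
  split=> //.
    move=> k; have [a [b [Eu ab sl sr [abN]]]] := sp k.
    rewrite leqn0 => /eqP b0; move: Eu ab sr abN; rewrite {}b0 !addn0.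
    case: a sl => // a sl Eu _ sr abN; right; exists a.
    rewrite /apply_acts /scan Eu /= /write /move /=; split=> //.
      by rewrite size_behead; lia.
    by case: (tright _) sr => //= _; apply: size_push.
  apply: leads1 => g; eapply comp_step_acts.
  - by reflexivity.
  - rewrite /spreading_step ifF; first by reflexivity.
    apply/negbTE/existsP => -[k]; have [a [b [Eu _ _ _ [_]]]] := sp k.
    by rewrite leqn0 => /eqP b0; rewrite /part_s /= /scan Eu b0.
  - by rewrite apply_stay.
  - by [].
  - by [].
have [/existsP ex|/existsP nex] := boolP [exists k, scan u k != None];
  last first.
  have [] := IH t u.
    move=> k; have [a [b [Eu ab sl sr [abN _]]]] := sp k.
    exists a, b; split=> //; split=> //.
    case: b Eu {ab sr abN} => // b Eu.
    by case: nex; exists k; rewrite /scan Eu.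
  by move=> n' [t' [u' [le_n' er H]]]; exists n', t', u'; split=> //;
    apply: leqW.
pose d k := if scan u k == None then Stay else GoRight.
have [] := IH (apply_acts (fun k => (None, d k)) t)
    (apply_acts (fun k => (scan u k, d k)) u).
  move=> k; have [a [b [Eu ab sl sr [abN le_b]]]] := sp k.
  rewrite /apply_acts /d /scan Eu.
  case: b {Eu} ab sr abN le_b => [|b] ab sr abN le_b.
    exists a, 0; split=> //=.
    by case: (tright (t k)) sr.
  exists a.+1, b; split=> //=; try lia.
    by apply: leq_trans (size_push _ _) _.
  case: (tright (t k)) sr => [|c r] //= sr.
  by case: r sr.
move=> n' [t' [u' [le_n' er H]]]; exists n'.+1, t', u'; split=> //.
apply: leads_step H => g; eapply comp_step_acts.
- by reflexivity.
- rewrite /spreading_step ifT; first by reflexivity.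
  by apply/existsP.
- by rewrite apply_stay.
- by [].
- by [].
Qed.

End Compute.

(** ** Simulating the oracle machine *)

Definition embed (c : config M) : config comp_machine :=
  comp_config (simulating (cstate c)) (ctape c)
    (fun=> blank_tape) (fun=> blank_tape).

Lemma embed_initial w : embed (initial M w) = initial comp_machine w.
Proof. by congr Config; apply/funext => -[k|[k []]]. Qed.

Lemma embed_halted c : halted (embed c) <-> halted c.
Proof.
rewrite /halted /= /simulating_step.
by case: (program _) => [b|q1 q2|d]; split=> -[b' // [->]]; exists b'.
Qed.

Lemma embed_accepting c : accepting (embed c) <-> accepting c.
Proof.
rewrite /accepting /= /simulating_step.
by case: (program _) => [b|q1 q2|d]; split=> // -[->].
Qed.

Variable x : language.
Variable f : seq bool -> seq bool.
Hypothesis computes_f : forall w gs, halted (run F (fun=> false) w gs) ->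
  tape_word (ctape (run F (fun=> false) w gs) (output_tape F)) = f w.
Hypothesis red : forall w, x w = y (f w).

(** [n] is the length of the query and [e] the time of [F]: the word is passed
    twice, [F] runs once, and the marked areas, of at most [n + e + 1] cells,
    are passed twice. *)
Definition query_cost (n e : nat) : nat := 5 * (n + e) + 9.

Lemma query_run (c : config M) yes no e :
  (forall k, neat (ctape c k)) -> program (cstate c) = Query yes no ->
  let w := tape_word (ctape c oM) in
  (forall gs, e <= size gs -> halted (run F (fun=> false) w gs)) ->
  exists n, n.+1 <= query_cost (size w) e /\
    forall g, leads y n.+1 (embed c) (embed (step x c g)).
Proof.
move=> nc Ec w hF; set m := ctape c.
have tm k : trimmed (m k) by apply/neat_trimmed/nc.
have [r Er [hr tr]] := tape_wordE (nc oM); rewrite -/m -/w in Er.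
set l := tleft (m oM).
have mE : upd_at m oM (Tape l (map some w ++ r)) = m.
  apply/funext => k; rewrite /upd_at; case: eqP => // ->.
  by rewrite -Er /l; case: (m oM).
have blankE : upd_at (fun=> blank_tape) iF blank_tape = fun=> blank_tape.
  by apply/funext => k; rewrite /upd_at; case: ifP.
(* [H1] enters the state [copying], [H2] copies the query, [H3] and [H4] go back
   to its beginning, [H5] starts [F]. *)
have H1 : leads y 1 (embed c)
    (comp_config (copying (yes, no)) m (fun=> blank_tape) (fun=> blank_tape)).
  apply: leads1 => g; eapply comp_step_acts.
  - by rewrite /= /simulating_step Ec; reflexivity.
  - by reflexivity.
  - by rewrite apply_stay.
  - by rewrite apply_stay_blank.
  - by rewrite apply_stay_blank.
have H2 := @copy_run m (yes, no) l r tm w [::].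
have H3 := @turn_run m (yes, no) l r tm hr tr (catrev w [::]).
have H4 := @return_run m (yes, no) l r tm tr (catrev w [::]) [::].
rewrite /= blankE mE in H2.
rewrite [catrev (catrev _ _) _](_ : _ = w) in H4; last first.
  by rewrite -![catrev _ [::]]/(rev _) revK.
have H5 := @begin_run m (yes, no) l r tm tr w.
rewrite mE in H4 H5.
have H := leads_trans H1 (leads_trans H2 (leads_trans H3 (leads_trans H4 H5))).
pose cF := initial F w.
have EcF : ctape cF = upd_at (fun=> blank_tape) iF (Tape [::] (map some w)).
  by apply/funext => k; rewrite /upd_at /=; case: eqP.
have sh0 k : shadowed (size w) (ctape cF k)
    (upd_at (fun=> blank_tape) iF (Tape [::] (nseq (size w) T)) k).
  rewrite EcF /upd_at; case: eqP => _; last by exists 0, 0.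
  exists 0, (size w).-1; split=> //=; first by case: (size w).
    by rewrite size_map; lia.
  lia.
have hlt : halted (foldl (step (fun=> false)) cF (nseq e false)).
  by apply: (hF (nseq e false)); rewrite size_nseq.
have [n1 [u1 [le1 sh1 K1]]] := compute_run (yes, no) tm sh0 hlt.
rewrite -EcF in H; have {}H := leads_trans H K1.
set cF' := foldl _ cF _ in hlt sh1 K1 H.
have [b Eb] := hlt.
have [u2 [cov K2]] := mark_run (yes, no) tm Eb sh1.
have {}H := leads_trans H K2.
set t2 := apply_acts _ _ in cov K2 H.
have K3 := forward_run m (yes, no) t2 u2.
have {}H := leads_trans H K3.
have ans : y (tape_word (t2 (output_tape F))) = x w.
  rewrite red -(computes_f hlt) /t2.
  rewrite -[apply_acts _ _ _]/(write (scanned (ctape cF' _)) (ctape cF' _)).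
  by rewrite tape_word_write_scanned.
rewrite ans /= in H.
set q' := (if x w then yes else no) in H.
have {}cov k : exists a b, [/\ u2 k = Tape (nseq a T) (nseq b T), 0 < a + b,
    size (tleft (t2 k)) <= a, size (tright (t2 k)) <= b &
    a + b <= (size w + e).+1 /\ b <= (size w + e).+1].
  have [p [q [? ? ? ? pq]]] := cov k; exists p, q; split=> //; split=> //.
  exact: leq_trans (leq_addl _ _) pq.
have [n2 [t3 [u3 [le2 er K4]]]] := spread_run tm q' cov.
have [n3 [le3 K5]] := wipe_run tm q' er.
have {}H := leads_trans H (leads_trans K4 K5).
have stepE g : step x c g = Config q' m by rewrite /step Ec.
move: H; set n := (X in leads y X) => H.
exists n.-1.
have n1E : n.-1.+1 = n by rewrite /n; lia.
rewrite n1E; split=> [|g]; last by rewrite stepE.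
have szr : size (catrev w [::]) = size w.
  by rewrite -[catrev _ _]/(rev _) size_rev.
rewrite /n /query_cost szr; lia.
Qed.

Lemma step_run (c : config M) e N :
  (forall k, neat (ctape c k)) -> size (tape_word (ctape c oM)) <= N ->
  (forall w gs, size w <= N -> e <= size gs ->
     halted (run F (fun=> false) w gs)) ->
  forall g, exists n, n < query_cost N e /\
    forall gs, size gs = n ->
      foldl (step y) (embed c) (g :: gs) = embed (step x c g).
Proof.
move=> nc le_w hF g; case E : (program (cstate c)) => [b|yes no|d].
- exists 0; split; first by rewrite /query_cost addnC.
  move=> [|//] _ /=; rewrite [RHS]/embed /step E /=.
  by rewrite /= /simulating_step E.
- have [n [le_n H]] := query_run nc E (fun gs => hF _ gs le_w).
  exists n; split; last by move=> gs sz; apply: H => /=; rewrite sz.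
  by apply: leq_trans le_n _; rewrite /query_cost; lia.
- exists 0; split; first by rewrite /query_cost addnC.
  move=> [|//] _ /=; case Ed : (d g (fun k => scanned (ctape c k))) => [q' a].
  rewrite /embed {2 3}/step E Ed /=; eapply comp_step_acts.
  + by rewrite /= /simulating_step E; reflexivity.
  + by rewrite /= -[part_m _]/(fun k => scanned (ctape c k)) Ed; reflexivity.
  + by [].
  + by rewrite apply_stay_blank.
  + by rewrite apply_stay_blank.
Qed.

Section Bounds.
Variable k : nat.
Hypothesis time_F : forall w gs, (size w).+2 ^ k <= size gs ->
  halted (run F (fun=> false) w gs).

Definition step_cost (n : nat) : nat := query_cost n (n.+2 ^ k).

Lemma run_step_run w gs0 n : size gs0 <= n ->
  forall g, exists n', n' < step_cost n /\
    forall gs, size gs = n' ->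
      foldl (step y) (embed (run M x w gs0)) (g :: gs) =
      embed (run M x w (rcons gs0 g)).
Proof.
move=> le_n g; rewrite /run foldl_rcons -/(run _ _ _ _); apply: step_run.
- exact: neat_run.
- exact: leq_trans (size_query _ _ _ _) le_n.
- move=> v gs le_v le_gs; apply: time_F; apply: leq_trans le_gs.
  exact: leq_expl.
Qed.

Lemma simulation_forward w gs :
  exists gs', run comp_machine y w gs' = embed (run M x w gs).
Proof.
elim/last_ind: gs => [|gs g [gs' IH]].
  by exists [::]; rewrite /run /= embed_initial.
have [n [_ H]] := @run_step_run w gs _ (leqnn _) g.
exists (gs' ++ g :: nseq n false); rewrite /run foldl_cat -/(run _ _ _ _) IH.
by apply: H; rewrite size_nseq.
Qed.

(** Conversely, each choice made by [M] is the choice read at the first of the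
    steps that imitate the corresponding step of [M]; the choices read in
    between are skipped. *)
Lemma simulation_backward w n t gs : t <= n -> t * step_cost n <= size gs ->
  exists gs0 j, [/\ size gs0 = t, j <= t * step_cost n &
    run comp_machine y w (take j gs) = embed (run M x w gs0)].
Proof.
elim: t => [|t IH] le_t le_gs.
  by exists [::], 0; split=> //; rewrite take0 /run /= embed_initial.
have [|gs0 [j [sz0 le_j E]]] := IH (ltnW le_t).
  by apply: leq_trans le_gs; rewrite leq_mul2r leqnSn orbT.
have sz0_n : size gs0 <= n by rewrite sz0 ltnW.
have [n' [lt_n' H]] := @run_step_run w gs0 n sz0_n (nth false gs j).
have le_jn : j + n'.+1 <= t.+1 * step_cost n.
  by rewrite mulSn addnC leq_add.
have le_jgs := leq_trans le_jn le_gs.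
exists (rcons gs0 (nth false gs j)), (j + n'.+1); rewrite size_rcons sz0;
  split=> //.
rewrite takeD /run foldl_cat -/(run _ _ _ _) E.
rewrite (drop_nth false); last by apply: leq_trans le_jgs;
  rewrite addnS ltnS leq_addr.
by rewrite /=; apply: H; rewrite size_takel // size_drop; lia.
Qed.

Variable a : nat.
Hypothesis time_M : forall w gs, (size w).+2 ^ a <= size gs ->
  halted (run M x w gs).

Definition comp_time (n : nat) : nat := n.+2 ^ a * step_cost (n.+2 ^ a).

Lemma comp_time_bounded : poly_bounded comp_time.
Proof.
apply: poly_bounded_mul; first by exists a.
apply: (@poly_bounded_comp step_cost); last by exists a.
apply: poly_bounded_add (poly_bounded_const 9).
apply: poly_bounded_mul (poly_bounded_const 5) _.
by apply: poly_bounded_add poly_bounded_id _; exists k.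
Qed.

Lemma comp_halts w gs : comp_time (size w) <= size gs ->
  exists gs0, run comp_machine y w gs = embed (run M x w gs0) /\
              halted (run M x w gs0).
Proof.
move=> le_gs; have [gs0 [j [sz0 _ E]]] := simulation_backward w (leqnn _) le_gs.
have hlt : halted (run M x w gs0) by apply: time_M; rewrite sz0.
exists gs0; split=> //; rewrite -E -{1}(cat_take_drop j gs) /run.
by apply: foldl_halted_leq; rewrite -/(run _ _ _ _) E; apply/embed_halted.
Qed.

Lemma comp_poly_time : poly_time comp_machine y.
Proof.
have [d hd] := comp_time_bounded; apply/poly_timeP; exists d => w gs le_gs.
have [gs0 [-> hlt]] := comp_halts (leq_trans (hd _) le_gs).
exact/embed_halted.
Qed.

Lemma comp_accepts w : accepts M x w <-> accepts comp_machine y w.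
Proof.
split=> [[gs acc]|].
  have [gs' E] := simulation_forward w gs.
  by exists gs'; rewrite E; apply/embed_accepting.
have long gs : comp_time (size w) <= size gs ->
    halted (run comp_machine y w gs).
  by move=> /comp_halts [gs0 [-> hlt]]; apply/embed_halted.
move/(accepts_long long) => [gs [sz acc]].
have [|gs0 [E _]] := @comp_halts w gs; first by rewrite sz.
by exists gs0; apply/embed_accepting; rewrite -E.
Qed.

End Bounds.
End Composition.

(** A query is no longer than the running time of [M], so each one is answered
    in polynomial time. *)
Lemma reduce_oracle M x y : many_one_reducible x y -> poly_time M x ->
  exists M', [/\ deterministic M -> deterministic M', poly_time M' y &
    forall w, accepts M x w <-> accepts M' y w].
Proof.
move=> [f [F [_ freeF poly_F comp_F]] red] poly_M.
have [k hk] := (poly_timeP F _).1 poly_F.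
have [a ha] := (poly_timeP M x).1 poly_M.
exists (comp_machine M F); split.
- exact: comp_deterministic.
- exact: (comp_poly_time freeF comp_F red hk ha).
- exact: (comp_accepts freeF comp_F red hk ha).
Qed.

Lemma P_eq_NP_reducible x y :
  many_one_reducible x y -> many_one_reducible y x ->
  P_rel x = NP_rel x -> P_rel y = NP_rel y.
Proof.
move=> xy yx /P_eq_NPP H; apply/P_eq_NPP => M pM.
have [M1 [_ pM1 a1]] := reduce_oracle yx pM.
have [M2 [d2 pM2 a2]] := H M1 pM1.
have [M3 [d3 pM3 a3]] := reduce_oracle xy pM2.
exists M3; split=> // [|w]; first exact: d3.
exact: iff_trans (a1 w) (iff_trans (a2 w) (a3 w)).
Qed.

Theorem mainTheorem4 : U [set x : language | P_rel x = NP_rel x].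
Proof.
split; last exact: winning_strategy.
  by move=> x y [xy yx]; split; apply: P_eq_NP_reducible.
exact: Borel_P_eq_NP.
Qed.
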